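(* Let $G$ be a connected graph of order $n\ge 15$. If $|E(G)|\ge \binom{n-4}{2}+5$, then $pc(G)\le 3$.
   Context: All graphs are finite and simple. In an edge-colored graph (adjacent edges may have the same color), a path is proper if no two adjacent edges of the path have the same color. An edge-coloring of a connected graph $G$ is a proper-path coloring if every two distinct vertices of $G$ are connected by a proper path. The proper connection number $pc(G)$ is the smallest number of colors in a proper-path coloring of $G$. *)

(* Defs.v *)
(* MathComp; classical reasoning (boolp) only serves to decide the predicate
   minimized in [pc]. *)
From mathcomp Require Import all_boot.
From mathcomp Require Import boolp.

Set Implicit Arguments.
Unset Strict Implicit.
Unset Printing Implicit Defensive.

Record sgraph := SGraph {
  vertex :> finType;
  adj : rel vertex;
  adj_sym : symmetric adj;
  adj_irrefl : irreflexive adj }.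

Definition edges (G : sgraph) : {set {set G}} :=
  [set [set p.1; p.2] | p : G * G & adj p.1 p.2].

Definition connected (G : sgraph) : Prop :=
  forall x y : G, connect (@adj G) x y.

(* [x :: s] is a path (no repeated vertex) whose sequence of edge colors has
   no two equal consecutive entries.  Only the values of [c] on [edges G]
   matter. *)
Definition proper_path (G : sgraph) (c : {set G} -> nat) (x : G) (s : seq G) :=
  [&& path (@adj G) x s, uniq (x :: s) &
      sorted (fun a b : nat => a != b)
             (pairmap (fun u v => c [set u; v]) x s)].

Definition proper_path_coloring (G : sgraph) (c : {set G} -> nat) : Prop :=
  forall x y : G, x != y -> exists2 s, proper_path c x s & last x s = y.

Definition proper_path_colorable (G : sgraph) (k : nat) : Prop :=
  exists2 c : {set G} -> nat,
    forall A, A \in edges G -> c A < k & proper_path_coloring c.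

Lemma proper_path_colorable_exists (G : sgraph) :
  connected G -> exists k, `[< proper_path_colorable G k >].
Proof.
move=> conn; exists #|{set G}|; apply/asboolP.
exists (fun A : {set G} => nat_of_ord (enum_rank A)) => [A _|x y _]; first exact: ltn_ord.
have /connectP[s0 s0P ->] := conn x y.
case/shortenP: s0P => s sP us _; exists s => //.
rewrite /proper_path sP us /=.
elim: s x sP us => [|u [|v s] IH] x //= /andP[xu uvP] /andP[xs us].
have {}IH := IH u uvP us; rewrite /= in IH; rewrite IH andbT.
apply/negP => /eqP /ord_inj /enum_rank_inj eqA.
have : x \in [set u; v] by rewrite -eqA set21.
by move: xs; rewrite !inE => /norP[/negPf-> /norP[/negPf->]].
Qed.

Definition pc (G : sgraph) (conn : connected G) : nat :=
  ex_minn (proper_path_colorable_exists conn).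

Lemma pc_leP (G : sgraph) (conn : connected G) (k : nat) :
  pc conn <= k <-> proper_path_colorable G k.
Proof.
rewrite /pc; case: ex_minnP => m /asboolP[c cm cP] minm; split.
  by move=> mk; exists c => // A /cm /leq_trans; apply.
by move=> /asboolP; apply: minm.
Qed.

(* Main.v *)
(** Grow a vertex set [W] together with a coloring of the edges inside [W] by
    three colors.  If some edge [zx] leaving [W] lies on a cycle, it starts an
    ear of [W], open or closed; otherwise it is a bridge and [x] is added alone.
    Two vertices not separated by a bridge are kept strongly joined: by two
    proper paths with distinct first colors and distinct last colors.  The ear
    is colored so as to close one of the proper paths between its ends to a
    properly colored cycle; a path leaving that cycle at some vertex can then
    be entered from at least one of the two directions, so strong joins extend
    to the ear.
    When a bridge is added at [z], its color must not be forced as the first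
    color from [z] to some other vertex; after [k] bridges at most [k] colors are
    forced at any vertex, so up to three bridges can be added.  Finally, four
    bridges cannot occur: they split the graph in at least five parts joined by
    four edges only, which leaves at most ['C(n - 4, 2) + 4] edges. *)
Require Import Defs.
From mathcomp Require Import all_boot.

Set Implicit Arguments.
Unset Strict Implicit.
Unset Printing Implicit Defensive.

(** * Color sequences and lists *)

Lemma sorted_cat_junction (r : rel nat) s t :
  sorted r (s ++ t) -> s != [::] -> t != [::] -> r (last 0 s) (head 0 t).
Proof. by case: s t => [|i s] [|j t] //=; rewrite cat_path /= => /and3P[]. Qed.

Lemma exists_color_avoiding (B : seq nat) :
  size B <= 2 -> exists2 i, i < 3 & i \notin B.
Proof.
move=> sB; have [/hasP[i]|/hasPn all_in] := boolP (has [predC B] (iota 0 3)).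
  by rewrite mem_iota => i3 iB; exists i.
have : size (iota 0 3) <= size B.
  by apply: uniq_leq_size (iota_uniq 0 3) _ => i /all_in; rewrite negbK.
by rewrite size_iota => /leq_trans/(_ sB).
Qed.

(** Only the last entry has two colors to avoid, its predecessor and [e], so three colors suffice.
    At least one entry is needed because [i] may equal [e]. *)
Lemma exists_proper_color_seq n i e :
  i < 3 -> exists t, [/\ size t = n.+1, {in t, forall j, j < 3},
    path (fun j k => j != k) i t & last i t != e].
Proof.
elim: n i => [|n IH] i i3.
  have [j j3] := @exists_color_avoiding [:: i; e] isT.
  rewrite !inE => /norP[ji je]; exists [:: j]; split=> //=.
    by move=> k; rewrite inE => /eqP->.
  by rewrite eq_sym ji.
have [j j3] := @exists_color_avoiding [:: i] isT; rewrite inE => ji.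
have [t [st t3 tP te]] := IH j j3; exists (j :: t); split=> //=.
- by rewrite st.
- by move=> k; rewrite inE => /orP[/eqP->|/t3].
- by rewrite eq_sym ji.
Qed.

(** Used to cut a path where it leaves a closed walk for the last time. *)
Lemma split_last_in (T : eqType) (A : pred T) x (s : seq T) :
  A x -> exists s1 s2, [/\ s = s1 ++ s2, A (last x s1) & ~~ has A s2].
Proof.
elim/last_ind: s => [|s y IH] Ax; first by exists [::], [::].
have [Ay|nAy] := boolP (A y).
  by exists (rcons s y), [::]; rewrite cats0 last_rcons.
have [s1 [s2 [-> A1 A2]]] := IH Ax; exists s1, (rcons s2 y).
by rewrite -rcons_cat has_rcons negb_or nAy.
Qed.

(** * Proper paths and their end colors *)

Section ColoredPaths.
Variable G : sgraph.
Implicit Types (c : {set G} -> nat) (x y z u v w a b : G) (p q ps : seq G)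
  (W X Y : {set G}).

Definition colors c x p := pairmap (fun u v => c [set u; v]) x p.

Lemma colors_cat c x p q :
  colors c x (p ++ q) = colors c x p ++ colors c (last x p) q.
Proof. exact: pairmap_cat. Qed.

Lemma colors_nil c x p : (colors c x p == [::]) = (p == [::]).
Proof. by case: p. Qed.

Lemma colors_rev c x p :
  colors c (last x p) (rev (belast x p)) = rev (colors c x p).
Proof.
elim: p x => [|y p IH] x //=.
rewrite !rev_cons -IH -!cats1 /colors pairmap_cat /= setUC.
by case: p {IH} => [|z p] //=; rewrite rev_cons last_rcons.
Qed.

Lemma proper_path_rev c x p :
  proper_path c x p -> proper_path c (last x p) (rev (belast x p)).
Proof.
case/and3P=> pP up cp; apply/and3P; split.
- by rewrite rev_path; under eq_path do rewrite adj_sym.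
- by rewrite -rev_rcons -lastI rev_uniq.
- rewrite -/(colors _ _ _) colors_rev rev_sorted.
  by under eq_sorted do rewrite eq_sym.
Qed.

Lemma proper_path_catl c x p q : proper_path c x (p ++ q) -> proper_path c x p.
Proof.
rewrite /proper_path -/(colors _ _ _) colors_cat -cat_cons cat_uniq cat_path.
by case/and3P=> /andP[pP _] /and3P[up _ _] /cat_sorted2[cp _]; apply/and3P.
Qed.

Lemma proper_path_catr c x p q :
  proper_path c x (p ++ q) -> proper_path c (last x p) q.
Proof.
rewrite /proper_path -/(colors _ _ _) colors_cat -cat_cons cat_uniq cat_path.
case/and3P=> /andP[_ qP] /and3P[_ dis uq] /cat_sorted2[_ cq]; apply/and3P.
split=> //=; rewrite uq andbT; apply: contra dis => lq.
by apply/hasP; exists (last x p); rewrite // mem_last.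
Qed.

(** The end colors and a set holding the path are all that gluing needs. Since [p] is nonempty, the
    default color 0 is never read. *)
Definition conn c X s x y e := exists p, [/\ proper_path c x p,
  last x p = y, {subset x :: p <= X}, p != [::] &
  head 0 (colors c x p) = s /\ last 0 (colors c x p) = e].

Lemma conn_path c x p : proper_path c x p -> p != [::] ->
  conn c [set v in x :: p] (head 0 (colors c x p)) x (last x p)
    (last 0 (colors c x p)).
Proof. by move=> pP p0; exists p; split=> //= v; rewrite in_set. Qed.

Lemma conn_sub c X Y s x y e : X \subset Y -> conn c X s x y e -> conn c Y s x y e.
Proof.
by move=> /subsetP XY [p [pP py pX p0 cp]]; exists p; split=> // v /pX /XY.
Qed.

Lemma conn_sym c X s x y e : conn c X s x y e -> conn c X e y x s.
Proof.
case=> p [pP py pX p0 [hp lp]]; exists (rev (belast x p)).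
rewrite -{}py; split.
- exact: proper_path_rev.
- by case: (p) p0 => [|v t] // _; rewrite /= rev_cons last_rcons.
- by move=> v; rewrite -rev_rcons -lastI mem_rev => /pX.
- by rewrite -size_eq0 size_rev size_belast size_eq0 p0.
- rewrite colors_rev -hp -lp; split.
    by case/lastP: (colors c x p) => [|t i] //; rewrite rev_rcons last_rcons.
  by case: (colors c x p) => [|i t] //; rewrite rev_cons last_rcons.
Qed.

(** Disjointness is asked of the sets holding the paths, so that it can be checked without looking
    into the paths. *)
Lemma conn_cat c X Y s x y e s' z e' :
  conn c X s x y e -> conn c Y s' y z e' -> e != s' ->
  (forall v, v \in X -> v \in Y -> v = y) -> conn c (X :|: Y) s x z e'.
Proof.
case=> p [/and3P[pP up cp] py pX p0 [hp lp]].
case=> q [/and3P[qP uq cq] qz qY q0 [hq lq]] es dis.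
have pq : colors c x (p ++ q) = colors c x p ++ colors c y q.
  by rewrite colors_cat py.
exists (p ++ q); split.
- apply/and3P; split; first by rewrite cat_path pP py.
    move: uq; rewrite -cat_cons cat_uniq up cons_uniq => /andP[yq ->]; rewrite andbT.
    apply/hasPn => v vq; apply: contra yq => vp.
    by rewrite -(dis v) // ?pX // qY // inE vq orbT.
  rewrite -/(colors _ _ _) pq.
  move: cp cq lp hq p0 q0; rewrite -!/(colors _ _ _).
  rewrite -(colors_nil c x) -(colors_nil c y).
  case: (colors c x p) (colors c y q) => [|i t] [|j t'] //= ti tj li ji _ _.
  by rewrite cat_path /= ti tj li ji es.
- by rewrite last_cat py.
- move=> v; rewrite -cat_cons mem_cat in_setU => /orP[/pX->//|vq].
  by rewrite (qY v) ?orbT // inE vq orbT.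
- by case: (p) p0 => [|? ?].
- rewrite pq last_cat -lq -hp.
  move: p0 q0; rewrite -(colors_nil c x) -(colors_nil c y).
  by case: (colors c x p) (colors c y q) => [|i t] [|j t'].
Qed.

Lemma colors_ext c c' X x p : (forall A : {set G}, A \subset X -> c' A = c A) ->
  {subset x :: p <= X} -> colors c' x p = colors c x p.
Proof.
move=> cc; elim: p x => [|y p IH] x //= pX.
rewrite IH => [|v vp]; last by apply: pX; rewrite inE vp orbT.
congr (_ :: _); apply: cc; apply/subsetP=> v; rewrite !inE => /orP[]/eqP->.
  by apply: pX; rewrite mem_head.
by apply: pX; rewrite !inE eqxx orbT.
Qed.

Lemma conn_ext c c' X s x y e : (forall A : {set G}, A \subset X -> c' A = c A) ->
  conn c X s x y e -> conn c' X s x y e.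
Proof.
move=> cc [p [/and3P[pP up cp] py pX p0 hl]].
have ce := colors_ext cc pX.
exists p; split=> //; last by rewrite ce.
by apply/and3P; split=> //; rewrite -/(colors _ _ _) ce.
Qed.

Lemma conn_edge c x y : x != y -> adj x y ->
  conn c [set x; y] (c [set x; y]) x y (c [set x; y]).
Proof.
move=> xy xyP; exists [:: y]; split=> //.
  by rewrite /proper_path /= inE xy xyP.
by move=> v; rewrite !inE.
Qed.

(** * Ears and strong joins *)

(* [a] and [b] may coincide: an ear can be closed. *)
Definition ear c a ps b := [/\ path (@adj G) a (rcons ps b), uniq (a :: ps),
  b \notin ps & sorted (fun i j : nat => i != j) (colors c a (rcons ps b))].

Lemma ear_prefix c a p1 v p2 b :
  ear c a (p1 ++ v :: p2) b -> proper_path c a (rcons p1 v).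
Proof.
rewrite -cat_rcons /ear rcons_cat colors_cat cat_path -cat_cons cat_uniq.
case=> /andP[pP _] /and3P[up _ _] _ /cat_sorted2[cp _].
by apply/and3P; split.
Qed.

Lemma ear_suffix c a p1 v p2 b :
  ear c a (p1 ++ v :: p2) b -> proper_path c v (rcons p2 b).
Proof.
case=> pP; rewrite cons_uniq cat_uniq => /and4P[_ _ _ up].
  rewrite mem_cat => /norP[_ bp].
move: pP; rewrite -cat_rcons rcons_cat cat_path colors_cat last_rcons.
case/andP=> _ pP /cat_sorted2[_ cp]; apply/and3P; split=> //.
by rewrite -rcons_cons rcons_uniq bp.
Qed.

Lemma ear_junction c a p1 v p2 b : ear c a (p1 ++ v :: p2) b ->
  last 0 (colors c a (rcons p1 v)) != head 0 (colors c v (rcons p2 b)).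
Proof.
case=> _ _ _; rewrite -cat_rcons rcons_cat colors_cat last_rcons => cp.
by apply: (sorted_cat_junction cp); rewrite colors_nil; [case: (p1)|case: (p2)].
Qed.

(** Whatever color arrives at an end, one of the two paths continues it properly. The paths may
    share inner vertices. *)
Definition strong c X x y := exists s1 e1 s2 e2,
  [/\ conn c X s1 x y e1, conn c X s2 x y e2, s1 != s2 & e1 != e2].

Lemma strong_sym c X x y : strong c X x y -> strong c X y x.
Proof.
case=> s1 [e1 [s2 [e2 [c1 c2 s12 e12]]]].
by exists e1, s1, e2, s2; split=> //; apply: conn_sym.
Qed.

Lemma strong_start c X x y i : strong c X x y -> exists s e, conn c X s x y e /\ s != i.
Proof.
case=> s1 [e1 [s2 [e2 [c1 c2 s12 _]]]]; have [s1i|s1i] := eqVneq s1 i.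
  by exists s2, e2; rewrite -s1i eq_sym.
by exists s1, e1.
Qed.

(** * Moving around the closed walk formed by an ear and a path of [W] *)

Section Ear.
Variables (c : {set G} -> nat) (W : {set G}) (a b : G) (ps q : seq G) (f l : nat).
Hypothesis earP : ear c a ps b.
Hypothesis psW : {in ps, forall v, v \notin W}.
Hypothesis qW : {subset a :: q <= W}.
Hypothesis qP : proper_path c a q.
Hypothesis qb : last a q = b.
Hypothesis ear_f : head 0 (colors c a (rcons ps b)) = f.
Hypothesis ear_l : last 0 (colors c a (rcons ps b)) = l.
(* The ear and [q] form a properly colored closed walk. *)
Hypothesis ear_q : path (fun i j => i != j) f (rcons (colors c a q) l).

Let E := [set v in ps].
Let Q := [set v in a :: q].

Lemma ear_route_first p1 v p2 : ps = p1 ++ v :: p2 ->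
  conn c [set u in a :: rcons p1 v] (last 0 (colors c a (rcons p1 v))) v a f.
Proof.
move=> psE; have := earP; rewrite psE => e; apply: conn_sym.
have := conn_path (ear_prefix e); rewrite last_rcons -ear_f psE.
rewrite -cat_rcons rcons_cat colors_cat.
by case: (p1) => [|w t] /=; apply.
Qed.

Lemma ear_route_last p1 v p2 : ps = p1 ++ v :: p2 ->
  conn c [set u in v :: rcons p2 b] (head 0 (colors c v (rcons p2 b))) v b l.
Proof.
move=> psE; have := earP; rewrite psE => e.
have := conn_path (ear_suffix e); rewrite last_rcons -ear_l psE.
rewrite -cat_rcons rcons_cat colors_cat last_rcons last_cat.
by case: (p2) => [|w t] /=; apply.
Qed.

Lemma ear_subset v p1 p2 : ps = p1 ++ v :: p2 ->
  [set u in a :: rcons p1 v] \subset E :|: [set a] /\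
  [set u in v :: rcons p2 b] \subset E :|: [set b].
Proof.
rewrite /E => ->; split; apply/subsetP=> u; rewrite !inE mem_rcons mem_cat !inE;
  by case: (u \in p1); case: (u \in p2); case: (u == v); case: (u == _).
Qed.

Lemma ear_cap u X : X \subset Q -> u \in E -> u \in X -> False.
Proof.
move=> /subsetP XQ; rewrite inE => /psW uW /XQ; rewrite inE => /qW.
by rewrite (negPf uW).
Qed.

(** The two routes are the two directions around the closed walk: their first colors differ because
    the ear is proper at [v], their last colors because the closed walk is proper at [z]. *)
Lemma ear_arrive v : v \in ps -> exists s t, [/\ s != t,
  conn c (E :|: [set a]) s v a f, conn c (E :|: [set b]) t v b l &
  forall z, z \in Q -> exists i j, [/\ i != j,
    conn c (E :|: Q) s v z i & conn c (E :|: Q) t v z j]].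
Proof.
move=> vps; have [p1 [p2 psE]] : exists p1 p2, ps = p1 ++ v :: p2.
  by case/splitPr: vps => p1 p2; exists p1, p2.
have [sub1 sub2] := ear_subset psE.
have route1 := conn_sub sub1 (ear_route_first psE).
have route2 := conn_sub sub2 (ear_route_last psE).
exists (last 0 (colors c a (rcons p1 v))), (head 0 (colors c v (rcons p2 b))).
split=> //; first by apply: ear_junction; rewrite -psE.
move=> z; rewrite inE => zQ.
have [q1 [q2 [qE lq1]]] : exists q1 q2, q = q1 ++ q2 /\ last a q1 = z.
  by case/splitPl: zQ => q1 q2 <-; exists q1, q2.
have lq2 : last z q2 = b by rewrite -lq1 -last_cat -qE.
have qP1 : proper_path c a q1 by move: qP; rewrite qE => /proper_path_catl.
have qP2 : proper_path c z q2 by move: qP; rewrite qE -lq1 => /proper_path_catr.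
have qQ := esym qE.
have sQ1 : [set u in a :: q1] \subset Q.
  by apply/subsetP=> u; rewrite !inE -qQ mem_cat => /orP[->|->]; rewrite ?orbT.
have sQ2 : [set u in z :: q2] \subset Q.
  apply/subsetP=> u; rewrite !in_set inE => /orP[/eqP->//|uq2].
  by rewrite -qQ inE mem_cat uq2 !orbT.
have aQ : [set a] \subset Q by rewrite sub1set inE mem_head.
have bQ : [set b] \subset Q by rewrite sub1set inE -qb mem_last.
move: ear_q; rewrite -qQ colors_cat lq1 -cats1 -catA cat_path => /andP[cq1 cq2].
(* The defaults matter: if [q1] is empty, the route stops at [a] and arrives by the ear with color
   [f]; likewise for [q2], [b] and [l]. *)
exists (last f (colors c a q1)), (head l (colors c z q2)); split.
- by move: cq2; case: (colors c z q2) => [|i t] /= /andP[].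
- have [q10|q10] := eqVneq q1 [::].
    move: lq1; rewrite q10 /= => <-; apply: conn_sub route1; exact: setUS.
  have := conn_path qP1 q10; rewrite lq1 => route3.
  have := conn_cat route1 route3.
  have -> : last 0 (colors c a q1) = last f (colors c a q1).
    by case: (q1) q10.
  move=> H; apply: conn_sub (H _ _).
  + by rewrite -setUA setUS // subUset aQ.
  + by move: cq1 q10; rewrite -(colors_nil c a); case: (colors c a q1) => //= i t /andP[].
  + move=> u; rewrite in_setU in_set1 => /orP[uE|/eqP//] uq.
    by case: (ear_cap sQ1 uE uq).
- have [q20|q20] := eqVneq q2 [::].
    move: lq2; rewrite q20 /= => ->; apply: conn_sub route2; exact: setUS.
  have := conn_sym (conn_path qP2 q20); rewrite lq2 => route3.
  have := conn_cat route2 route3.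
  have -> : head 0 (colors c z q2) = head l (colors c z q2).
    by case: (q2) q20.
  move=> H; apply: conn_sub (H _ _).
  + by rewrite -setUA setUS // subUset bQ.
  + move: cq2 q20; rewrite -(colors_nil c z) cats1 rcons_path => /andP[_].
    by case: (colors c z q2) => //= i t; rewrite eq_sym.
  + move=> u; rewrite in_setU in_set1 => /orP[uE|/eqP//] uq.
    by case: (ear_cap sQ2 uE uq).
Qed.

(* A path leaving [Q] for good at [z] extends one of the two routes to [z],
   since these end in different colors. *)
Lemma ear_outside v : v \in ps -> exists s t, [/\ s != t,
  forall z, z \in Q -> exists i j, [/\ i != j,
    conn c (W :|: E) s v z i & conn c (W :|: E) t v z j],
  forall i z e, conn c W i a z e -> i != f -> conn c (W :|: E) s v z e,
  forall i z e, conn c W i b z e -> i != l -> conn c (W :|: E) t v z e &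
  forall i z e, z \notin Q -> conn c W i a z e ->
    conn c (W :|: E) s v z e \/ conn c (W :|: E) t v z e].
Proof.
move=> vps; have [s [t [st sa tb arr]]] := ear_arrive vps.
have QW : Q \subset W by apply/subsetP=> u; rewrite inE => /qW.
have ext x i i' z e k : x \in Q -> conn c (E :|: [set x]) k v x i ->
    conn c W i' x z e -> i' != i -> conn c (W :|: E) k v z e.
  move=> xQ c1 c2 ii; have := conn_cat c1 c2; rewrite eq_sym => /(_ ii) H.
  apply: conn_sub (H _).
    rewrite subUset subsetUl andbT subUset subsetUr sub1set inE.
    by rewrite (subsetP QW).
  move=> u; rewrite in_setU in_set1 => /orP[|/eqP//].
  by rewrite inE => /psW/negPf ->.
have aQ : a \in Q by rewrite inE mem_head.
have bQ : b \in Q by rewrite inE -qb mem_last.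
exists s, t; split=> //.
- move=> z /arr[i [j [ij c1 c2]]]; exists i, j.
  by split=> //; [apply: conn_sub c1|apply: conn_sub c2];
    rewrite setUC setSU.
- by move=> i z e cz si; apply: ext sa cz si.
- by move=> i z e cz si; apply: ext tb cz si.
move=> i z e zQ [p [pP pz pW p0 [hp lp]]].
(* Only the part [p2] after the last visit [y] to [Q] is kept; it meets the closed walk in [y]
   alone, so either direction around to [y] can be followed by it if the colors allow. *)
have [p1 [p2 [pE p1Q p2Q]]] := @split_last_in _ (mem Q) a p aQ.
set y := last a p1 in p1Q.
have p20 : p2 != [::].
  by apply: contra zQ => /eqP p20; rewrite -pz pE p20 cats0.
have p2P : proper_path c y p2 by move: pP; rewrite pE => /proper_path_catr.
have := conn_path p2P p20.
have -> : last y p2 = z by rewrite -pz pE last_cat.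
have -> : last 0 (colors c y p2) = e.
  rewrite -lp pE colors_cat last_cat -/y.
  by move: p20; rewrite -(colors_nil c y); case: (colors c y p2).
set k := head 0 _ => tail.
have [i1 [j1 [ij1 c1 c2]]] := arr _ p1Q.
have junction h g : g != k -> conn c (E :|: Q) h v y g ->
    conn c (W :|: E) h v z e.
  move=> gk c3; have := conn_cat c3 tail gk => H; apply: conn_sub (H _).
    rewrite subUset subUset subsetUr (subset_trans QW) ?subsetUl //=.
    apply/subsetP=> u; rewrite in_set => up; rewrite inE pW //.
    move: up; rewrite pE -cat_cons mem_cat inE => /orP[/eqP->|->].
      by rewrite mem_last.
    by rewrite orbT.
  move=> u; rewrite in_setU => uEQ; rewrite in_set inE.
  case/orP=> [/eqP//|up2]; move: uEQ; rewrite in_set => /orP[/psW|]; last first.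
    by rewrite in_set => uQ; case/hasP: p2Q; exists u; rewrite //= inE.
  by rewrite pW // pE inE mem_cat up2 !orbT.
have [ik|ik] := eqVneq i1 k; last by left; apply: junction ik c1.
by right; apply: junction c2; rewrite -ik eq_sym.
Qed.

(** The vertices [u] and [v] cut the closed walk into two paths, one along the ear and one through
    [q]; properness of the ear at [u] and at [v] makes their end colors differ. *)
Lemma ear_strong u v : u \in ps -> v \in ps -> u != v -> strong c (W :|: E) u v.
Proof.
wlog : u v / exists p1 p2 p3, ps = p1 ++ u :: p2 ++ v :: p3.
  move=> H ups vps uv; have [p1 [p2 psE]] : exists p1 p2, ps = p1 ++ u :: p2.
    by case/splitPr: ups => p1 p2; exists p1, p2.
  move: (vps); rewrite psE mem_cat inE eq_sym (negPf uv) /=.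
  case/orP=> /splitPr vp.
    apply: strong_sym; apply: H; rewrite // 1?eq_sym //.
    case: vp psE => m1 m2 psE; exists m1, m2, p2.
    by rewrite psE -catA.
  by apply: H => //; case: vp psE => m1 m2 psE; exists p1, m1, m2.
case=> p1 [p2 [p3 psE]] ups vps uv.
have psE' : ps = (p1 ++ u :: p2) ++ v :: p3 by rewrite psE -catA.
have [sub1 _] := ear_subset psE; have [_ sub3] := ear_subset psE'.
have route1 := ear_route_first psE.
have route3 := conn_sym (ear_route_last psE').
have [_ up _ _] := earP.
have midP : proper_path c u (rcons p2 v).
  have := earP; rewrite psE => /ear_suffix.
  by rewrite -cat_rcons rcons_cat => /proper_path_catl.
have p2v : rcons p2 v != [::] by case: (p2).
have := conn_path midP p2v; rewrite last_rcons => mid.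
set X1 := [set _ in _] in route1 sub1; set X3 := [set _ in _] in route3 sub3.
have cap13 x : x \in X1 -> x \in X3 -> x = b.
  rewrite !in_set !inE !mem_rcons !inE => x1 x3.
  have [//|xb] := eqVneq x b; rewrite (negPf xb) /= in x3.
  move: up; rewrite psE' -cat_cons cat_uniq => /and3P[_ /hasPn/(_ x)].
  rewrite !inE mem_cat inE x3 => /(_ isT).
  by case/or3P: x1 => ->; rewrite ?orbT.
have capQ3 x : x \in Q -> x \in X3 -> x = b.
  move=> xQ; move/(subsetP sub3); rewrite in_setU in_set1 => /orP[xE|/eqP//].
  by case: (ear_cap (subxx _) xE xQ).
have around : conn c (W :|: E) (last 0 (colors c a (rcons p1 u))) u v
    (head 0 (colors c v (rcons p3 b))).
  have subW : X1 :|: Q :|: X3 \subset W :|: E.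
    have QW : Q \subset W by apply/subsetP=> x; rewrite inE => /qW.
    have aW : a \in W by rewrite qW ?mem_head.
    have bW : b \in W by rewrite qW -?qb ?mem_last.
    rewrite !subUset (subset_trans QW) ?subsetUl //= andbT.
    by rewrite (subset_trans sub1) ?(subset_trans sub3) // subUset subsetUr
      sub1set inE ?aW ?bW.
  (* An empty [q] means a closed ear: its two outer pieces meet directly at [a], with colors [f] and
     [l]. *)
  have [q0|q0] := eqVneq q [::].
    have ab : b = a by rewrite -qb q0.
    have route3a : conn c X3 l a v (head 0 (colors c v (rcons p3 b))).
      by rewrite -[a in conn _ _ _ a]ab.
    have := conn_cat route1 route3a => H.
    apply: conn_sub (H _ _).
    + by apply: subset_trans subW; rewrite setSU // subsetUl.
    + by move: ear_q; rewrite q0 /= andbT.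
    + by rewrite -ab; apply: cap13.
  have := conn_path qP q0; rewrite qb => routeQ.
  have junction_a : f != head 0 (colors c a q).
    move: ear_q q0; rewrite -(colors_nil c a).
    by case: (colors c a q) => //= i t /andP[].
  have junction_b : last 0 (colors c a q) != l.
    move: ear_q q0; rewrite -(colors_nil c a) rcons_path => /andP[_].
    by case: (colors c a q).
  have dis1 x : x \in X1 -> x \in Q -> x = a.
    move=> /(subsetP sub1); rewrite in_setU in_set1 => /orP[xE xQ|/eqP//].
    by case: (ear_cap (subxx _) xE xQ).
  apply: conn_sub subW (conn_cat (conn_cat route1 routeQ _ dis1) route3 _ _) => //.
  by move=> x; rewrite in_setU => /orP[]; [apply: cap13|apply: capQ3].
exists (head 0 (colors c u (rcons p2 v))), (last 0 (colors c u (rcons p2 v))).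
exists (last 0 (colors c a (rcons p1 u))), (head 0 (colors c v (rcons p3 b))).
split=> //.
- apply: conn_sub mid; apply/subsetP=> x; rewrite in_set => xp.
  rewrite !inE psE mem_cat inE mem_cat inE.
  move: xp; rewrite inE mem_rcons inE => /or3P[->|->|->]; rewrite ?orbT //.
- have := earP; rewrite psE => /ear_junction; rewrite eq_sym.
  by case: (p2).
- have := earP; rewrite psE' => /ear_junction.
  by rewrite -cat_rcons rcons_cat colors_cat last_cat last_rcons; case: (p2).
Qed.

End Ear.

(** * Coloring an ear *)

Definition path_edges x p := pairmap (fun u v => [set u; v]) x p.

Lemma colors_edges c x p : colors c x p = map c (path_edges x p).
Proof. by elim: p x => //= y p IH x; rewrite -IH. Qed.

Lemma path_edges_sub x p A : A \in path_edges x p -> A \subset x :: p.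
Proof.
elim: p x => //= y p IH x; rewrite inE => /orP[/eqP->|/IH Ap].
  by apply/subsetP=> v; rewrite !inE => /orP[]->; rewrite ?orbT.
by apply/subsetP=> v /(subsetP Ap); rewrite [in X in _ -> X]inE orbC => ->.
Qed.

Lemma path_edges_uniq x p : uniq (x :: p) -> uniq (path_edges x p).
Proof.
elim: p x => //= y p IH x /andP[xp up]; rewrite IH // andbT.
apply: contra xp => /path_edges_sub/subsetP; apply; exact: set21.
Qed.

(** An ear can be colored freely only if it repeats no edge. A closed ear with one inner vertex
    would run back along its first edge; the last hypothesis excludes this. *)
Lemma ear_edges_uniq a ps b : uniq (a :: ps) -> b \notin ps ->
  (a != b) || (1 < size ps) -> uniq (path_edges a (rcons ps b)).
Proof.
case: ps => [|y ps] //= /andP[aps /andP[yps ups]] bps ab.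
rewrite path_edges_uniq; last by rewrite -rcons_cons rcons_uniq bps /= yps.
rewrite andbT; case: ps => [|z ps] /= in aps yps ups bps ab *.
  rewrite orbF in ab; rewrite inE; apply: contra ab => /eqP ayE.
  have : a \in [set y; b] by rewrite -ayE set21.
  by rewrite !inE in aps *; rewrite (negPf aps).
rewrite inE negb_or; apply/andP; split.
  apply: contra aps => /eqP ayE.
  have : a \in [set y; z] by rewrite -ayE set21.
  by rewrite !inE => /orP[]->; rewrite ?orbT.
apply/negP => /path_edges_sub/subsetP/(_ y); rewrite set22 => /(_ isT).
rewrite inE mem_rcons inE.
move: yps bps; rewrite !inE => /norP[/negPf-> /negPf->] /norP[yb _].
by rewrite eq_sym (negPf yb).
Qed.

Lemma recolor c (s : seq {set G}) (t : seq nat) : uniq s -> size t = size s ->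
  exists c', map c' s = t /\ forall A, A \notin s -> c' A = c A.
Proof.
move=> us st; exists (fun A => if A \in s then nth 0 t (index A s) else c A).
split=> [|A /negPf->//]; apply: (@eq_from_nth _ 0); rewrite size_map // => i i_s.
by rewrite (nth_map set0) // mem_nth // index_uniq.
Qed.

(** Hence coloring an ear changes no color inside [W]. *)
Lemma path_edges_ear a ps b W : {in ps, forall v, v \notin W} -> ps != [::] ->
  forall A, A \in path_edges a (rcons ps b) -> ~~ (A \subset W).
Proof.
elim: ps a => //= y ps IH a psW _ A; rewrite inE => /orP[/eqP->|].
  by apply/subsetPn; exists y; rewrite ?set22 // psW ?mem_head.
case: ps => [|z ps] /= in psW IH *.
  rewrite inE => /eqP->; apply/subsetPn; exists y; rewrite ?set21 //.
  by rewrite psW ?mem_head.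
by apply: IH => // v vp; apply: psW; rewrite inE vp orbT.
Qed.

(** The choices are made in this order: [f] outside [B], then a path [q] from [a] to [b] not
    starting with [f], provided by the strong join, and finally the other ear colors, ending
    differently from [q]. *)
Lemma ear_coloring c W a ps b B : (forall A, c A < 3) -> a \in W ->
  ps != [::] -> path (@adj G) a (rcons ps b) -> uniq (a :: ps) -> b \notin ps ->
  {in ps, forall v, v \notin W} -> (a != b) || (1 < size ps) ->
  (a != b -> strong c W a b) -> size B <= 2 ->
  exists c' q f l, [/\
    [/\ forall A, c' A < 3, forall A : {set G}, A \subset W -> c' A = c A & f \notin B],
    ear c' a ps b,
    [/\ {subset a :: q <= W}, proper_path c' a q & last a q = b],
    head 0 (colors c' a (rcons ps b)) = f /\ last 0 (colors c' a (rcons ps b)) = l &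
    path (fun i j => i != j) f (rcons (colors c' a q) l)].
Proof.
move=> c3 aW ps0 pP ups bps psW ab_ps ab_strong sB.
have [f f3 fB] := exists_color_avoiding sB.
have [q [qW qP qb qf]] : exists q, [/\ {subset a :: q <= W}, proper_path c a q,
    last a q = b & path (fun i j => i != j) f (colors c a q)].
  have [<-|/ab_strong/(strong_start f)] := eqVneq a b.
    by exists [::]; split=> // v; rewrite inE => /eqP->.
  case=> [s [e [[q [qP qb qW q0 [hq _]]] sf]]].
  exists q; split=> //; case/and3P: qP => _ _; rewrite -/(colors c a q).
  by move: hq; case: (colors c a q) => //= i t ->; rewrite eq_sym sf.
have [n szn] : exists n, size ps = n.+1 by case: (ps) ps0 => // y p _; exists (size p).
(* For a closed ear [q] is empty and the default [f] is the color to avoid at the end: the first and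
   last ear edges then meet at [a]. *)
have [t [szt t3 tP tl]] := exists_proper_color_seq n (last f (colors c a q)) f3.
have sz_ft : size (f :: t) = size (path_edges a (rcons ps b)).
  by rewrite size_pairmap size_rcons /= szt szn.
have [c' [c't c'c]] := recolor c (ear_edges_uniq ups bps ab_ps) sz_ft.
have agree (A : {set G}) : A \subset W -> c' A = c A.
  by move=> AW; apply: c'c; apply: contraL AW; apply: path_edges_ear.
have qE := colors_ext agree qW.
exists c', q, f, (last 0 (f :: t)).
have earE : colors c' a (rcons ps b) = f :: t by rewrite colors_edges.
split=> //.
- split=> // A; have [Ae|/c'c->//] := boolP (A \in path_edges a (rcons ps b)).
  have : c' A \in f :: t by rewrite -c't map_f.
  by rewrite inE => /orP[/eqP->//|/t3].
- by split; rewrite ?earE.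
- split=> //; move: qP; rewrite /proper_path -!/(colors _ _ _) qE //.
- by rewrite earE.
- by rewrite qE rcons_path qf eq_sym.
Qed.

(** * Extending a coloring by an ear or by a single edge *)

Definition connected_in c W x y := exists s e, conn c W s x y e.

(* [avoid c W z B]: no color outside [B] is forced at [z] on the way to some
   vertex of [W]. *)
Definition avoid c W z (B : seq nat) := forall i w, i \notin B -> w \in W ->
  w != z -> exists s e, conn c W s z w e /\ s != i.

Lemma strong_connected c W x y : strong c W x y -> connected_in c W x y.
Proof. by case=> s [e [_ [_ [cs _ _ _]]]]; exists s, e. Qed.

(** In the applications [B] lists colors that may be forced at [a]. As [f] is chosen outside [B],
    every vertex of [W] can then be reached from the ear through [a]. *)
Lemma ear_step c W a ps b B : (forall A, c A < 3) -> a \in W -> b \in W ->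
  ps != [::] -> path (@adj G) a (rcons ps b) -> uniq ps ->
  {in ps, forall v, v \notin W} -> (a != b) || (1 < size ps) ->
  (a != b -> strong c W a b) -> size B <= 2 ->
  {in W &, forall x y, x != y -> connected_in c W x y} ->
  exists c', let W' := W :|: [set v in ps] in
  [/\ (forall A, c' A < 3) /\ (forall A : {set G}, A \subset W -> c' A = c A),
    {in ps & W, forall u w, connected_in c' W' u w},
    {in ps &, forall u v, u != v -> strong c' W' u v},
    {in ps & W, forall u w, (w != a -> strong c W a w) ->
       (w != b -> strong c W b w) -> strong c' W' u w} &
    {in W, forall z B', avoid c W z B' -> avoid c' W' z B'} /\
    (avoid c W a B -> {in ps, forall u, exists i, avoid c' W' u [:: i]})].
Proof.
move=> c3 aW bW ps0 pP ups psW ab_ps ab_strong sB Wc.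
have uaps : uniq (a :: ps).
  by rewrite /= ups andbT; apply/negP => /psW; rewrite aW.
have bps : b \notin ps by apply/negP => /psW; rewrite bW.
have [c' [q [f [l [[c'3 agree fB] earP [qW qP qb] [ef el] eq]]]]] :=
  ear_coloring c3 aW ps0 pP uaps bps psW ab_ps ab_strong sB.
have out := ear_outside earP psW qW qP qb ef el eq.
have in_ear := ear_strong earP psW qW qP qb ef el eq.
have up := conn_ext agree.
set W' := W :|: _ in out in_ear *.
have aQ : a \in [set v in a :: q] by rewrite inE mem_head.
have bQ : b \in [set v in a :: q] by rewrite inE -qb mem_last.
have WW' : W \subset W' by rewrite subsetUl.
have W'P v : v \in W' -> v \in W \/ v \in ps by rewrite !inE => /orP.
exists c'; rewrite /= -/W'; split=> //.
- move=> u w /out[s [t [_ onQ _ _ dir]]] wW.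
  have [/onQ[i [j [_ cs _]]]|wQ] := boolP (w \in [set v in a :: q]).
    by exists s, i.
  have aw : a != w by apply: contraNneq wQ => <-.
  have [i [e /up caw]] := Wc _ _ aW wW aw.
  by case: (dir _ _ _ wQ caw) => ?; [exists s, e|exists t, e].
- move=> u w /out[s [t [st onQ viaA viaB dir]]] wW saw sbw.
  have [/onQ[i [j [ij cs ct]]]|wQ] := boolP (w \in [set v in a :: q]).
    by exists s, i, t, j.
  have wa : w != a by apply: contraNneq wQ => ->.
  have wb : w != b by apply: contraNneq wQ => ->.
  have [i1 [e1 [i2 [e2 [/up c1 /up c2 i12 e12]]]]] := saw wa.
  (* If both paths to [w] extend in the same direction from [u], any path in the other direction
     completes the strong join: its last color differs from [e1] or from [e2]. *)
  have combine k k' : k != k' ->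
      (exists g, conn c' W' k' u w g) -> conn c' W' k u w e1 ->
      conn c' W' k u w e2 -> strong c' W' u w.
    move=> kk' [g cg] ck1 ck2; have [e1g|e1g] := eqVneq e1 g.
      by exists k, e2, k', g; split=> //; rewrite -e1g eq_sym.
    by exists k, e1, k', g.
  case: (dir _ _ _ wQ c1) (dir _ _ _ wQ c2) => d1 [] d2.
  + apply: combine d1 d2 => //; first exact: st.
    have [k [g [/up cg kl]]] := strong_start l (sbw wb).
    by exists g; apply: viaB cg kl.
  + by exists s, e1, t, e2.
  + by exists t, e1, s, e2; split=> //; rewrite eq_sym.
  + apply: combine d1 d2; first by rewrite eq_sym; apply: st.
    have [k [g [/up cg kl]]] := strong_start f (saw wa).
    by exists g; apply: viaA cg kl.
split.
- move=> z zW B' avz i w iB /W'P[wW|wps] wz.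
    have [s [e [cs si]]] := avz i w iB wW wz.
    by exists s, e; split=> //; apply: conn_sub WW' _; apply: up.
  have [s [t [st onQ _ _ dir]]] := out w wps.
  have [/onQ[i1 [j1 [ij cs ct]]]|zQ] := boolP (z \in [set v in a :: q]).
    have [i1i|i1i] := eqVneq i1 i.
      by exists j1, t; split; [apply: conn_sym|rewrite -i1i eq_sym].
    by exists i1, s; split=> //; apply: conn_sym.
  have az : a != z by apply: contraNneq zQ => <-.
  (* A path from [z] to [a] avoiding [i] at [z] is prolonged to [w] by one of the two directions;
     its color at [z] is unchanged. *)
  have [k [e [/up/conn_sym cz ki]]] := avz i a iB aW az.
  case: (dir _ _ _ zQ cz) => /conn_sym czw; by [exists k, s|exists k, t].
- move=> ava u ups'; have [s [t [st onQ viaA _ _]]] := out u ups'.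
  (* Only [s], the color at [u] towards [a], can be forced: all of [W] is reached starting with [s],
     and the ear vertices are strongly joined to [u]. *)
  exists s => i w; rewrite inE eq_sym => si /W'P[wW|wps] wu.
    have [wa|wa] := eqVneq w a.
      by have [i1 [j1 [_ cs _]]] := onQ a aQ; exists s, i1; rewrite wa.
    have [k [e [/up cw kf]]] := ava _ _ fB wW wa.
    by exists s, e; split=> //; apply: viaA cw kf.
  by apply: strong_start; apply: in_ear => //; rewrite eq_sym.
Qed.

(** All paths out of [x] start with [i], so [i] is the one color forced at [x]. An old vertex [w]
    gains at most one forced color, the color at [w] of the path found to [x]. *)
Lemma bridge_step c W z x i : (forall A, c A < 3) -> z \in W -> x \notin W ->
  adj z x -> i < 3 ->
  (forall w, w \in W -> w != z -> exists s e, conn c W s z w e /\ s != i) ->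
  exists c', let W' := x |: W in
  [/\ (forall A, c' A < 3) /\ (forall A : {set G}, A \subset W -> c' A = c A),
    {in W, forall w, connected_in c' W' x w},
    avoid c' W' x [:: i] &
    {in W, forall w B, avoid c W w B -> exists e, avoid c' W' w (e :: B)}].
Proof.
move=> c3 zW xW zx i3 avz.
pose c' (A : {set G}) := if A \subset W then c A else i.
have agree (A : {set G}) : A \subset W -> c' A = c A by rewrite /c' => ->.
have xz : x != z by apply: contraNneq xW => ->.
have cxz : c' [set x; z] = i.
  by rewrite /c' subUset sub1set (negPf xW).
have xzP : adj x z by rewrite adj_sym.
have exz := conn_edge c' xz xzP; rewrite cxz in exz.
have WW' : W \subset x |: W by rewrite subsetUr.
have xzW' : [set x; z] \subset x |: W.
  by rewrite subUset !sub1set setU11 (subsetP WW').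
have from_x w : w \in W -> exists e, conn c' (x |: W) i x w e.
  move=> wW; have [->|wz] := eqVneq w z.
    by exists i; apply: conn_sub exz.
  have [s [e [/(conn_ext agree) cs si]]] := avz w wW wz.
  exists e; rewrite eq_sym in si; have := conn_cat exz cs si => H.
  apply: conn_sub (H _); first by rewrite subUset xzW'.
  by move=> v; rewrite !inE => /orP[]/eqP-> // xW'; rewrite xW' in xW.
exists c'; split.
- by split=> // A; rewrite /c'; case: ifP.
- by move=> w /from_x[e ce]; exists i, e.
- move=> j w; rewrite inE eq_sym => ij /setU1P[->|/from_x[e ce] _].
    by rewrite eqxx.
  by exists i, e.
- move=> w wW B avw; have [e ce] := from_x w wW; exists e => j v.
  rewrite inE => /norP[je jB] /setU1P[-> _|vW vw].
    by exists e, i; split; [apply: conn_sym|rewrite eq_sym].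
  have [s [g [/(conn_ext agree) cs sj]]] := avw j v jB vW vw.
  by exists s, g; split=> //; apply: conn_sub cs.
Qed.

(** * Cuts and the count of edges *)

(* A cut is recorded as a vertex set together with the only edge leaving it. *)
Definition signature (cuts : seq ({set G} * {set G})) x :=
  [seq x \in (K : {set G} * {set G}).1 | K <- cuts].

(** The representatives witness that the cuts produce at least one part more than their number. As
    the cut edges lie inside [W], no ear crosses a cut; as the representatives lie in [W], a vertex
    behind a new bridge differs from all of them. *)
Definition separated W (cuts : seq ({set G} * {set G})) :=
  (forall K, K \in cuts -> forall u v, adj u v -> u \in K.1 -> v \notin K.1 ->
     [set u; v] = K.2 /\ K.2 \subset W) /\
  exists reps : seq G, [/\ size reps = (size cuts).+1, {subset reps <= W} &
    uniq (map (signature cuts) reps)].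

Lemma separated_edge W cuts u v : separated W cuts -> adj u v ->
  signature cuts u != signature cuts v ->
  [set u; v] \in map snd cuts /\ [set u; v] \subset W.
Proof.
case=> cutP _ uv nuv.
have [K Kcuts Kuv] : exists2 K, K \in cuts & (u \in K.1) != (v \in K.1).
  apply/hasP; apply: contraR nuv => /hasPn nS; apply/eqP/eq_in_map => K /nS.
  by rewrite negbK => /eqP.
have [uK|uK] := boolP (u \in K.1); have [vK|vK] := boolP (v \in K.1).
- by rewrite uK vK in Kuv.
- by have [-> KW] := cutP K Kcuts u v uv uK vK; split=> //; apply: map_f.
- rewrite adj_sym in uv; rewrite setUC.
  by have [-> KW] := cutP K Kcuts v u uv vK uK; split=> //; apply: map_f.
- by rewrite (negPf uK) (negPf vK) in Kuv.
Qed.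

(* Every vertex that is not a representative has the signature of at most one
   representative; so apart from the recorded edges, the edges lie among the
   non-representatives or are determined by one of these. *)
Lemma separated_edges_bound W cuts : separated W cuts ->
  #|edges G| <= 'C(#|G| - size cuts, 2) + size cuts.
Proof.
move=> sep; have [_ [reps [sz_reps _ sig_uniq]]] := sep.
pose sig := signature cuts; have ur : uniq reps := map_uniq sig_uniq.
pose N := ~: [set r in reps].
have cardN : #|N| = #|G| - (size cuts).+1.
  by rewrite cardsCs setCK cardsE (card_uniqP ur) sz_reps.
have lt_cuts : size cuts < #|G|.
  by rewrite -sz_reps -(card_uniqP ur) max_card.
(* If no representative shares the signature of [v], the default [v] only puts a harmless singleton
   into [I]. *)
pose pr v := odflt v [pick r | (r \in reps) && (sig r == sig v)].
have prE v r : r \in reps -> sig r = sig v -> pr v = r.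
  move=> rr rv; rewrite /pr; case: pickP => [r' /andP[r'r /eqP r'v]|/(_ r)] /=.
    move: sig_uniq => /(nth_uniq (sig r)) Hn.
    have : index r' reps == index r reps.
      rewrite -Hn ?size_map ?index_mem //.
      by rewrite !(nth_map r) ?index_mem // !nth_index // -/sig rv r'v.
    move/eqP/(congr1 (nth r reps)); rewrite !nth_index //.
  by rewrite rr rv eqxx.
pose D := [set A : {set G} | A \subset N & #|A| == 2].
pose I := [set [set v; pr v] | v in N].
pose F := [set A in map snd cuts].
have sub : edges G \subset D :|: I :|: F.
  apply/subsetP=> A /imsetP[[u v]]; rewrite inE /= => uv ->.
  rewrite !in_setU; have [suv|suv] := eqVneq (sig u) (sig v); last first.
    by have [uvF _] := separated_edge sep uv suv; rewrite [_ \in F]inE uvF orbT.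
  have nuv : u != v by apply: contraTneq uv => ->; rewrite adj_irrefl.
  have [ur'|ur'] := boolP (u \in reps).
    have vN : v \in N.
      rewrite !inE; apply: contra nuv => vr.
      by rewrite -(prE v u) // (prE v v).
    by rewrite setUC -(prE v u) // (imset_f (fun v => [set v; pr v])) ?orbT.
  have uN : u \in N by rewrite !inE.
  have [vr|vr] := boolP (v \in reps).
    by rewrite -(prE u v) // (imset_f (fun v => [set v; pr v])) ?orbT.
  by rewrite inE subUset !sub1set uN !inE vr cards2 nuv.
apply: leq_trans (subset_leq_card sub) _.
apply: leq_trans (leq_card_setU _ _) _; apply: leq_add; last first.
  by rewrite cardsE -(size_map snd cuts) card_size.
apply: leq_trans (leq_card_setU _ _) _.
(* Pascal's rule: pairs inside [N] plus one further edge for each vertex of [N] give the binomial of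
   [#|N|] plus one. *)
rewrite cards_draws cardN -[#|G| - size cuts]prednK ?subn_gt0 //.
by rewrite -subnS binS bin1 leq_add2l -cardN leq_imset_card.
Qed.

(** * The invariant and its preservation *)

(** Strong joins are kept only within a part. The bound on forced colors is kept while there are at
    most two cuts, when it leaves a free color for the next bridge. *)
Definition colored c W cuts := [/\ forall A, c A < 3,
  {in W &, forall x y, x != y -> connected_in c W x y},
  {in W &, forall x y, x != y -> signature cuts x = signature cuts y ->
     strong c W x y} &
  size cuts <= 2 ->
    {in W, forall z, exists2 B, size B <= size cuts & avoid c W z B}].

(** Edges between different parts lie inside [W], whereas each edge of the ear has an end outside
    [W]. *)
Lemma ear_signature W cuts a ps b : separated W cuts -> ps != [::] ->
  path (@adj G) a (rcons ps b) -> {in ps, forall v, v \notin W} ->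
  signature cuts a = signature cuts b /\
  {in ps, forall v, signature cuts a = signature cuts v}.
Proof.
move=> sep; elim: ps a => // y ps IH a _ /= /andP[ay pP] psW.
have same u v : adj u v -> ~~ ([set u; v] \subset W) ->
    signature cuts u = signature cuts v.
  move=> uv uvW; apply/eqP; apply: contraR uvW => suv.
  by have [] := separated_edge sep uv suv.
have yW : y \notin W by rewrite psW ?mem_head.
have ayE : signature cuts a = signature cuts y.
  by apply: same; rewrite // subUset !sub1set (negPf yW) andbF.
case: ps => [|z ps] in IH pP psW *.
  move: pP; rewrite /= andbT => yb; split=> [|v]; last by rewrite inE => /eqP->.
  by rewrite ayE; apply: same; rewrite // subUset !sub1set (negPf yW).
have [|yb yps] := IH y isT pP; first by move=> v vp; rewrite psW // inE vp orbT.
by rewrite ayE; split=> // v; rewrite inE => /orP[/eqP->|/yps].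
Qed.

Lemma strong_ext c c' W X x y : (forall A : {set G}, A \subset W -> c' A = c A) ->
  W \subset X -> strong c W x y -> strong c' X x y.
Proof.
move=> cc WX [s [e [s' [e' [c1 c2 ss ee]]]]]; exists s, e, s', e'.
by split=> //; apply: conn_sub WX _; apply: conn_ext cc _.
Qed.

Lemma connected_ext c c' W X x y : (forall A : {set G}, A \subset W -> c' A = c A) ->
  W \subset X -> connected_in c W x y -> connected_in c' X x y.
Proof.
move=> cc WX [s [e c1]]; exists s, e.
by apply: conn_sub WX _; apply: conn_ext cc _.
Qed.

Lemma connected_in_sym c W x y : connected_in c W x y -> connected_in c W y x.
Proof. by case=> s [e c1]; exists e, s; apply: conn_sym. Qed.

Lemma grow_ear c W cuts a ps b : separated W cuts -> colored c W cuts ->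
  a \in W -> b \in W -> ps != [::] -> path (@adj G) a (rcons ps b) -> uniq ps ->
  {in ps, forall v, v \notin W} -> (a != b) || (1 < size ps) ->
  exists c', separated (W :|: [set v in ps]) cuts /\
             colored c' (W :|: [set v in ps]) cuts.
Proof.
move=> sep [c3 Wc Ws Wav] aW bW ps0 pP ups psW ab_ps.
have [ab aps] := ear_signature sep ps0 pP psW.
have ab_strong : a != b -> strong c W a b by move=> /Ws; apply.
(* With three cuts no forced colors are tracked any more, and [f] may be arbitrary. *)
have [B sB avB] : exists2 B, size B <= 2 & size cuts <= 2 -> avoid c W a B.
  have [s2|] := boolP (size cuts <= 2); last by exists [::].
  by have [B sB avB] := Wav s2 a aW; exists B; rewrite // (leq_trans sB).
have [c' [[c'3 agree] out_c in_s out_s [av_old av_new]]] :=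
  ear_step c3 aW bW ps0 pP ups psW ab_ps ab_strong sB Wc.
set W' := W :|: _ in out_c in_s out_s av_old av_new *.
have WW' : W \subset W' by rewrite subsetUl.
have W'P v : v \in W' -> v \in W \/ v \in ps by rewrite !inE => /orP.
have strong_out u w : u \in ps -> w \in W -> signature cuts u = signature cuts w ->
    strong c' W' u w.
  move=> ups' wW uw; apply: out_s => //; rewrite eq_sym => /Ws; apply=> //.
    by rewrite -uw; apply: aps.
  by rewrite -uw -ab; apply: aps.
have strong' : {in W' &, forall x y, x != y ->
    signature cuts x = signature cuts y -> strong c' W' x y}.
  move=> x y /W'P[xW|xps] /W'P[yW|yps] xy sxy.
  - by apply: strong_ext agree WW' _; apply: Ws.
  - by apply: strong_sym; apply: strong_out.
  - exact: strong_out.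
  - exact: in_s.
exists c'; split.
  case: sep => cutP [reps [szr rW ru]]; split; last first.
    by exists reps; split=> // r /rW; apply: (subsetP WW').
  move=> K Sc u v uv uS vS; have [-> SW] := cutP K Sc u v uv uS vS.
  by split=> //; apply: subset_trans WW'.
split=> //.
- move=> x y /W'P[xW|xps] /W'P[yW|yps] xy.
  + by apply: connected_ext agree WW' _; apply: Wc.
  + by apply: connected_in_sym; apply: out_c.
  + exact: out_c.
  + by apply: strong_connected; apply: in_s.
move=> s2 z /W'P[zW|zps].
  by have [B' sB' avz] := Wav s2 z zW; exists B' => //; apply: av_old.
(* Without cuts everything is strongly joined and nothing is forced; with a cut, the single color
   forced at an ear vertex is within the bound. *)
have [cuts0|cuts0] := posnP (size cuts).
  exists [::] => // i w _ wW' wz; apply: strong_start; apply: strong' => //.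
  + by rewrite !inE zps orbT.
  + by rewrite eq_sym.
  + by rewrite (size0nil cuts0).
by have [i avz] := av_new (avB s2) z zps; exists [:: i].
Qed.

Lemma bridge_separated W cuts z x (K : {set G}) : separated W cuts ->
  z \in W -> x \in K -> [disjoint K & W] ->
  (forall u v, adj u v -> u \in K -> v \notin K -> [set u; v] = [set z; x]) ->
  separated (x |: W) ((K, [set z; x]) :: cuts).
Proof.
move=> [cutP [reps [szr rW ru]]] zW xK KW Kcut.
have WW' : W \subset x |: W by rewrite subsetUr.
split.
  move=> T; rewrite inE => /orP[/eqP->|Tc] u v uv uT vT /=.
    split; first exact: Kcut.
    by rewrite subUset !sub1set setU11 (subsetP WW').
  have [-> TW] := cutP T Tc u v uv uT vT.
  by split=> //; apply: subset_trans WW'.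
exists (x :: reps); split=> /=.
- by rewrite szr.
- by move=> r; rewrite inE => /orP[/eqP->|/rW]; [apply: setU11|apply: (subsetP WW')].
apply/andP; split.
  apply/mapP => -[r /rW rW' []]; rewrite xK => /esym.
  by rewrite (disjointFl KW rW').
(* Dropping the entry of [K] recovers the old signatures, already distinct. *)
by apply: (@map_uniq _ _ behead); rewrite -map_comp.
Qed.

(** At most two colors are forced at [z], so a third is free for the bridge. No strong join is owed
    to [x], since [K] separates it from all of [W]. *)
Lemma grow_bridge c W cuts z x : colored c W cuts ->
  size cuts <= 2 -> z \in W -> x \notin W -> adj z x ->
  forall K : {set G}, x \in K -> [disjoint K & W] ->
  exists c', colored c' (x |: W) ((K, [set z; x]) :: cuts).
Proof.
move=> [c3 Wc Ws Wav] s2 zW xW zx K xK KW.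
have [B sB avB] := Wav s2 z zW.
have [i i3 iB] := exists_color_avoiding (leq_trans sB s2).
have [c' [[c'3 agree] from_x av_x av_old]] := bridge_step c3 zW xW zx i3
  (fun w => avB i w iB).
set W' := x |: W in from_x av_x av_old *.
have WW' : W \subset W' by rewrite subsetUr.
pose cuts' := (K, [set z; x]) :: cuts.
have new_sig w : w \in W -> signature cuts' x != signature cuts' w.
  by move=> wW; rewrite /= /signature /= xK (disjointFl KW wW).
exists c'; split=> //.
- move=> u v /setU1P[->|uW] /setU1P[->|vW] uv.
  + by rewrite eqxx in uv.
  + exact: from_x.
  + by apply: connected_in_sym; apply: from_x.
  + by apply: connected_ext agree WW' _; apply: Wc.
- move=> u v /setU1P[->|uW] /setU1P[->|vW] uv suv.
  + by rewrite eqxx in uv.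
  + by case/eqP: (new_sig v vW).
  + by case/eqP: (new_sig u uW).
  + apply: strong_ext agree WW' _; apply: Ws => //; by case: suv.
move=> _ w /setU1P[->|wW]; first by exists [:: i].
have [B' sB' avw] := Wav s2 w wW; have [e ave] := av_old w wW B' avw.
by exists (e :: B').
Qed.

Lemma grow c W cuts : connected G -> separated W cuts -> colored c W cuts ->
  size cuts <= 3 -> 'C(#|G| - 4, 2) + 5 <= #|edges G| -> W != setT ->
  exists c' W' cuts', [/\ W \proper W', size cuts' <= 3, separated W' cuts' &
                          colored c' W' cuts'].
Proof.
move=> conn sep col s3 many WT.
have [r rW] : exists r, r \in W.
  case: sep => _ [[|r reps] [] // _ rW _]; exists r; apply: rW; exact: mem_head.
have [y _ yW] : exists2 y, y \in setT & y \notin W.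
  by apply/subsetPn; rewrite subTset.
have [z [x [zW xW zx]]] : exists z x, [/\ z \in W, x \notin W & adj z x].
  have /connectP[p pP py] := conn r y.
  elim: p r rW pP py => [|v p IH] r rW /=.
    by move=> _ yr; rewrite yr rW in yW.
  case/andP=> rv vP; have [vW|vW _] := boolP (v \in W); first exact: IH.
  by exists r, v.
(* Here [K] is what [x] reaches without the edge [zx]. If [K] misses [W], only that edge leaves [K],
   a new cut; otherwise a simple path back, stopped at its first vertex in [W], is an ear. *)
pose e : rel G := fun u v => adj u v && ([set u; v] != [set z; x]).
pose K := [set v | connect e x v].
have xK : x \in K by rewrite inE.
have [KW|] := boolP [disjoint K & W].
  have sep' : separated (x |: W) ((K, [set z; x]) :: cuts).
    apply: bridge_separated => // u v uv uK vK; apply/eqP.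
    apply: contraR vK => uvz; rewrite !inE in uK *.
    by apply: connect_trans uK (connect1 _); rewrite /e uv.
  (* A fourth cut would bound the number of edges by one less than assumed. *)
  have s2 : size cuts <= 2.
    rewrite -ltnS ltn_neqAle s3 andbT; apply/negP => /eqP s3E.
    have := separated_edges_bound sep'; rewrite /= s3E.
    by move/(leq_trans many); rewrite leq_add2l.
  have [c' col'] := grow_bridge col s2 zW xW zx xK KW.
  exists c', (x |: W), ((K, [set z; x]) :: cuts); split=> //.
  by rewrite properE subsetUr /=; apply/subsetPn; exists x; rewrite ?setU11.
case/pred0Pn => w /andP[/=]; rewrite in_set => /connectP[p0 /shortenP[p pP up _] ->] wW.
have hp : has (mem W) p.
  case: (p) wW => [|v p'] wW; first by rewrite /= (negPf xW) in wW.
  by apply/hasP; exists (last v p'); rewrite ?mem_last.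
case/split_find: hp pP up {wW} => b s1 s2 bW s1W.
rewrite cat_path => /andP[pP _] up.
have e_adj : subrel e (@adj G) by move=> u v /andP[].
have [||||c' [sep' col']] := @grow_ear c W cuts z (x :: s1) b sep col zW bW isT.
- by rewrite /= zx (sub_path e_adj).
- move: up; rewrite -cat_cons -rcons_cons cat_uniq rcons_uniq.
  by case/andP=> /andP[].
- move=> v; rewrite inE => /orP[/eqP->//|vs1].
  by apply: contra s1W => vW; apply/hasP; exists v.
(* A closed ear with the single inner vertex [x] would return along the edge [zx], which [e]
   omits. *)
- case: (s1) pP => [|v t] /=; last by rewrite orbT.
  rewrite andbT orbF => /andP[_]; apply: contraNneq => ->.
  by rewrite setUC.
exists c', (W :|: [set v in x :: s1]), cuts; split=> //.
rewrite properE subsetUl /=; apply/subsetPn; exists x => //.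
by rewrite !inE eqxx orbT.
Qed.

End ColoredPaths.

(** * Growing a single vertex to the whole graph *)

Theorem theorem5p5 (G : sgraph) (conn : connected G) :
  15 <= #|G| ->
  'C(#|G| - 4, 2) + 5 <= #|edges G| ->
  pc conn <= 3.
Proof.
move=> n15 many; apply/pc_leP.
have /card_gt0P[r _] : 0 < #|G| by apply: leq_trans n15.
(* Induction on the number of vertices outside [W], from [[set r]] without cuts, where the invariant
   is vacuous for pairs and any coloring serves. *)
suff H n (c : {set G} -> nat) (W : {set G}) cuts :
    #|~: W| <= n -> separated W cuts -> colored c W cuts -> size cuts <= 3 ->
    proper_path_colorable G 3.
  apply: (H #|~: [set r]| (fun=> 0) [set r] [::]) => //.
    by split=> //; exists [:: r]; split=> // v; rewrite !inE.
  have one x y : x \in [set r] -> y \in [set r] -> x != y -> False.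
    by move=> /set1P-> /set1P->; rewrite eqxx.
  split=> // [x y xr yr /(one x y xr yr)//|x y xr yr /(one x y xr yr)//|_ z zr].
  by exists [::] => // i w _ wr /(one w z wr zr).
elim: n c W cuts => [|n IH] c W cuts Wn sep col s3.
  have WT : W = setT.
    by move: Wn; rewrite -[W]setCK leqn0 setCK cards_eq0 => /eqP->; rewrite setC0.
  case: col => c3 Wc _ _; exists c => // x y xy.
  have [|| s [e [p [pP py _ _ _]]]] := Wc x y _ _ xy; rewrite ?WT ?inE //.
  by exists p.
have [WT|WT] := eqVneq W setT.
  by apply: (IH c W cuts) => //; rewrite WT setCT cards0.
have [c' [W' [cuts' [WW' s3' sep' col']]]] := grow conn sep col s3 many WT.
apply: IH sep' col' s3'; rewrite -ltnS; apply: leq_trans Wn.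
by apply: proper_card; rewrite properC.
Qed.
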